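(* Let $n>k\ge h\ge1$, weights $w_1,\ldots,w_n>0$, and $\delta:=\frac{k-h+1/2}{k+1/2}$. There is an online algorithm that, given requests $r_1,r_2,\ldots\in[n]$, maintains a sequence of fractional solutions $x^t\in P_\delta$ with $x^t_{r_t}=\delta$ and $\|x^t\|_1=n-h$, such that for every horizon $T_0$, \[ \sum_{t=1}^{T_0}\|x^t-x^{t-1}\|_w \le (\log 1/\delta)\cdot \sum_{t=1}^{T_0}\|y^t-y^{t-1}\|_w + C' \] for any sequence of feasible solutions $y^t$ with $y^t\in P\cap\{0,1\}^n$ and $y^t_{r_t}=0$. Here $C'$ is a constant depending on the weights $w_i$ and on $k,h$, but independent of the request sequence.
   Context: $P:=\{x\in[0,1]^n : \sum_i x_i\ge n-h\}$ is the anti-paging polytope and $P_\delta:=\{x\in[\delta,1]^n:\sum_i x_i\ge n-h\}$. The weighted $\ell_1$ norm is $\|x\|_w:=\sum_i w_i|x_i|$. $\log$ is the natural logarithm. *)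

(* Defs.v *)
From mathcomp Require Import all_boot all_order all_algebra.
From mathcomp Require Import classical_sets reals exp.

Set Implicit Arguments.
Unset Strict Implicit.
Unset Printing Implicit Defensive.

Import Order.TTheory GRing.Theory Num.Theory.

Local Open Scope classical_set_scope.
Local Open Scope ring_scope.

Section AntiPaging.
Context {R : realType} {n : nat}.
Implicit Types (w : 'I_n -> R) (x : 'rV[R]_n) (h : nat) (delta : R).

Definition wnorm1 w x : R := \sum_(i < n) w i * `|x 0 i|.

Definition norm1 x : R := wnorm1 (fun=> 1) x.

Definition antipaging h : set 'rV[R]_n :=
  [set x | (forall i, 0 <= x 0 i <= 1)
           /\ n%:R - h%:R <= \sum_(i < n) x 0 i].

Definition antipaging_delta h delta : set 'rV[R]_n :=
  [set x | (forall i, delta <= x 0 i <= 1)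
           /\ n%:R - h%:R <= \sum_(i < n) x 0 i].

Definition zero_one : set 'rV[R]_n :=
  [set x | forall i, x 0 i = 0 \/ x 0 i = 1].

(* A deterministic online algorithm: the solution held after serving the
   requests r_1, ..., r_t is a function of that prefix only; its value on
   [::] is the initial solution. *)
Definition online_algorithm : Type := seq 'I_n -> 'rV[R]_n.

(* Requests are numbered from 1; [r 0] is never read. *)
Definition run (alg : online_algorithm) (r : nat -> 'I_n) (t : nat) :
    'rV[R]_n :=
  alg [seq r s | s <- iota 1 t].

Definition movement w (x : nat -> 'rV[R]_n) (T : nat) : R :=
  \sum_(1 <= t < T.+1) wnorm1 w (x t - x t.-1).

End AntiPaging.

Arguments online_algorithm : clear implicits.

Definition delta_of {R : realType} (k h : nat) : R :=
  (k%:R - h%:R + 1 / 2) / (k%:R + 1 / 2).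

(* Main.v *)
Require Import Defs.
From mathcomp Require Import all_boot all_order all_algebra.
From mathcomp Require Import classical_sets reals exp.
From mathcomp Require Import boolp topology normedtype sequences.
From mathcomp Require Import ring lra.

Import Order.TTheory GRing.Theory Num.Theory.
Import numFieldNormedType.Exports.

Local Open Scope classical_set_scope.
Local Open Scope ring_scope.

(** On a request [r], lower [x_r] to [delta] and replace every other [x_i] by
    [min(1, x_i e^(lam/w_i))], with [lam >= 0] chosen so that the sum stays
    equal to [n - h]. This is the exact solution of the mirror-descent flow
    [x_i' = x_i / w_i] stopped at [1], so no differential equation is needed.
    The potential
      [Psi(x, y) = sum_i w_i (x_i - 2 y_i ln x_i - ln(1/delta) y_i)]
    is bounded. If [y] moves while [x] is fixed it grows by at most
    [ln(1/delta) |dy|_w], because [0 <= - ln x_i <= ln(1/delta)]. If then [x]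
    moves, [|dx|_w + dPsi <= 2 lam sum_(i != r) (x'_i - y_i)], which is
    nonpositive because [y_r = 0] and [sum_i y_i >= n - h = sum_i x'_i]. *)

(** * Capped exponential growth of one coordinate *)

Section CappedUpdate.
Set Implicit Arguments.
Unset Strict Implicit.
Context {R : realType}.
Implicit Types (x y w lam delta : R).

Definition capped_growth x w lam : R := Num.min 1 (x * expR (lam / w)).

Lemma continuous_capped_growth x w : continuous (capped_growth x w).
Proof.
apply (@min_fun_continuous _ R R (fun=> 1) (fun l => x * expR (l / w))).
  exact: cst_continuous.
move=> lam; apply: cvgM; first exact: cvg_cst.
apply: (@continuous_comp R R R (fun l => l / w) expR).
  by apply: cvgM; [exact: cvg_id|exact: cvg_cst].
exact: continuous_expR.
Qed.

Lemma capped_growth0 x w : x <= 1 -> capped_growth x w 0 = x.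
Proof. by move=> x1; rewrite /capped_growth mul0r expR0 mulr1 min_r. Qed.

Lemma le_capped_growth x w lam : 0 < w -> 0 <= lam -> 0 <= x <= 1 ->
  x <= capped_growth x w lam.
Proof.
move=> w0 l0 /andP[x0 x1]; rewrite le_min x1 /= ler_peMr//.
by rewrite -expR0 ler_expR divr_ge0// ltW.
Qed.

Lemma capped_growth_le1 x w lam : capped_growth x w lam <= 1.
Proof. by rewrite ge_min lexx. Qed.

(** Once [lam / w] reaches [ln (1 / delta)], the growth factor is at least [1 / delta], enough to
    lift even [delta] to the cap. *)
Lemma capped_growth_saturated delta x w lam :
  0 < delta <= x -> 0 < w -> w * ln (1 / delta) <= lam ->
  capped_growth x w lam = 1.
Proof.
move=> /andP[d0 dx] w0 wlam; apply: min_l.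
apply: (@le_trans _ _ (delta * (1 / delta))).
  by rewrite mulrC divfK// gt_eqF.
apply: ler_pM => //; [exact: ltW|by rewrite divr_ge0// ltW|].
rewrite -[leLHS]lnK; last by rewrite posrE divr_gt0.
by rewrite ler_expR ler_pdivlMr// mulrC.
Qed.

(** This is [ln (1 + z) <= z] at [z = x / y - 1], multiplied by [y]. *)
Lemma subr_le_mul_ln x y : 0 < x -> 0 < y -> y - x <= y * (ln y - ln x).
Proof.
move=> x0 y0; have xy0 : 0 < x / y by rewrite divr_gt0.
have : ln (1 + (x / y - 1)) <= x / y - 1 by apply: le_ln1Dx; lra.
rewrite addrC subrK ln_div ?posrE// => H.
have -> : y - x = - (y * (x / y - 1)) by field; rewrite gt_eqF.
by rewrite -mulrN ler_pM2l//; lra.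
Qed.

(** Put [g = w * (ln x' - ln x)]. The left side is at most [(x' - y) * g]. Below the cap [g = lam];
    at the cap only [g <= lam] holds, but then [x' - y = 1 - y] is nonnegative. *)
Lemma capped_growth_cost x x' y w lam :
  0 < x <= 1 -> 0 <= y <= 1 -> 0 < w -> 0 <= lam ->
  x' = capped_growth x w lam ->
  w * (x' - x) - y * (w * (ln x' - ln x)) <= (x' - y) * lam.
Proof.
move=> /andP[x0 x1] /andP[y0 y1] w0 l0 x'E.
have xx' : x <= x' by rewrite x'E; apply: le_capped_growth; rewrite // ltW.
have x'0 : 0 < x' := lt_le_trans x0 xx'.
have cost : w * (x' - x) <= x' * (w * (ln x' - ln x)).
  by rewrite mulrCA ler_pM2l// subr_le_mul_ln.
suff : (x' - y) * (w * (ln x' - ln x)) <= (x' - y) * lam by lra.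
have lnE : ln (x * expR (lam / w)) = ln x + lam / w.
  by rewrite lnM ?posrE ?expR_gt0// expRK.
have lamE : w * (lam / w) = lam by rewrite mulrC divfK// gt_eqF.
rewrite x'E /capped_growth; have [sat|unsat] := leP 1 (x * expR (lam / w)).
  rewrite ler_wpM2l ?subr_ge0// -[leRHS]lamE ler_pM2l// lerBlDl -lnE.
  by rewrite ler_ln// ?posrE ?mulr_gt0 ?expR_gt0.
by rewrite lnE addrAC subrr add0r lamE.
Qed.

End CappedUpdate.

(** * Serving one request *)

Section Step.
Set Implicit Arguments.
Unset Strict Implicit.
Context {R : realType} {n : nat} (w : 'I_n -> R) (hw : forall i, 0 < w i).
Context (delta s : R) (delta_gt0 : 0 < delta).

Definition feasible (x : 'rV[R]_n) : Prop :=
  (forall i, delta <= x 0 i <= 1) /\ \sum_(i < n) x 0 i = s.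

(** Intermediate value theorem: the sum is [s - x_r <= s - delta] at [lam = 0], and equals
    [n - 1 >= s - delta] once all coordinates are capped. *)
Lemma capped_growth_level (x : 'rV[R]_n) (r : 'I_n) :
  feasible x -> s <= n%:R - 1 + delta ->
  exists2 lam : R, 0 <= lam &
    \sum_(i < n | i != r) capped_growth (x 0 i) (w i) lam = s - delta.
Proof.
move=> [xb xs] sn; pose f (lam : R) :=
  \sum_(i < n | i != r) capped_growth (x 0 i) (w i) lam.
(* The sum dominates each saturation level [w i * ln (1 / delta)], so it serves all coordinates at
   once. *)
pose M := \sum_(i < n) w i * ln (1 / delta).
have delta_le1 : delta <= 1 by have /andP[/le_trans] := xb r; apply.
have wL_ge0 i : 0 <= w i * ln (1 / delta).
  by rewrite mulr_ge0 ?ln_ge0 ?ler_pdivlMr ?mul1r// ltW.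
have M0 : 0 <= M by apply: sumr_ge0.
have f0 : f 0 = s - x 0 r.
  rewrite -xs (bigD1 r)//= addrAC subrr add0r; apply: eq_bigr => i _.
  by rewrite capped_growth0//; have /andP[] := xb i.
have fM : f M = n%:R - 1.
  rewrite /f (eq_bigr (fun=> 1)) => [|i _].
    rewrite sumr_const (cardC1 r) card_ord.
    by rewrite -subn1 natrB// (leq_trans _ (ltn_ord r)).
  apply: (@capped_growth_saturated _ delta) => //.
    by rewrite delta_gt0; have /andP[] := xb i.
  by rewrite /M (bigD1 i)//= lerDl sumr_ge0.
have [||lam] := @IVT R f 0 M (s - delta) M0.
- apply: continuous_subspaceT; apply: continuous_big => [|i _].
    exact: add_continuous.
  exact: continuous_capped_growth.
- have /andP[xr _] := xb r.
  rewrite f0 fM ge_min le_max; apply/andP; split; apply/orP; [left|right]; lra.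
by rewrite in_itv => /andP[l0 _] fl; exists lam.
Qed.

(** The last clause bounds the movement plus the change of the potential at fixed [y]. As [y] is
    quantified after [x'], the step cannot depend on the comparator. *)
Definition step_spec (x : 'rV[R]_n) (r : 'I_n) (x' : 'rV[R]_n) : Prop :=
  [/\ feasible x', x' 0 r = delta &
    forall y : 'rV[R]_n,
      (forall i, 0 <= y 0 i <= 1) -> s <= \sum_(i < n) y 0 i -> y 0 r = 0 ->
      \sum_(i < n) w i * (`|x' 0 i - x 0 i| + (x' 0 i - x 0 i)
                          - 2 * y 0 i * (ln (x' 0 i) - ln (x 0 i))) <= 0].

Lemma step_exists (x : 'rV[R]_n) (r : 'I_n) :
  feasible x -> s <= n%:R - 1 + delta -> exists x', step_spec x r x'.
Proof.
move=> xf sn; have [lam l0 lamE] := capped_growth_level r xf sn.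
have [xb _] := xf.
pose x' : 'rV[R]_n :=
  \row_i if i == r then delta else capped_growth (x 0 i) (w i) lam.
have x'r : x' 0 r = delta by rewrite mxE eqxx.
have x'i i : i != r -> x' 0 i = capped_growth (x 0 i) (w i) lam.
  by move=> ir; rewrite mxE (negbTE ir).
have x_gt0 i : 0 < x 0 i by apply: lt_le_trans delta_gt0 _; case/andP: (xb i).
have xx' i : i != r -> x 0 i <= x' 0 i.
  move=> ir; rewrite x'i// le_capped_growth// ltW//.
  by case/andP: (xb i).
have x's : \sum_(i < n | i != r) x' 0 i = s - delta.
  by rewrite -lamE; apply: eq_bigr => i; exact: x'i.
exists x'; split=> //.
  split=> [i|]; last by rewrite (bigD1 r)//= x'r x's addrC subrK.
  have [->|ir] := eqVneq i r.
    by rewrite x'r lexx; have /andP[/le_trans] := xb r; apply.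
  have /andP[dx _] := xb i.
  by rewrite (le_trans dx (xx' _ ir)) x'i// capped_growth_le1.
(* Coordinate [r] contributes 0: it decreases, so [|d| + d = 0], and [y_r = 0] removes its
   logarithm. *)
move=> y yb ys yr; rewrite (bigD1 r)//= yr x'r.
have -> : `|delta - x 0 r| = - (delta - x 0 r).
  by rewrite ler0_norm// subr_le0; case/andP: (xb r).
rewrite addNr mulr0 mul0r subr0 mulr0 add0r.
apply: (@le_trans _ _ (\sum_(i < n | i != r) (x' 0 i - y 0 i) * (2 * lam))).
  apply: ler_sum => i ir; rewrite ger0_norm ?subr_ge0 ?xx'//.
  have /andP[_ x1] := xb i.
  have := @capped_growth_cost R (x 0 i) (x' 0 i) (y 0 i) (w i) lam.
  by rewrite x_gt0 x1 => /(_ isT (yb i) (hw i) l0 (x'i _ ir)); lra.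
(* Since [y_r = 0], the other [y_i] sum to at least [s], while the other [x'_i] sum to
   [s - delta]. *)
rewrite -big_distrl/= sumrB x's; apply: mulr_le0_ge0; last by rewrite mulr_ge0.
move: ys; rewrite (bigD1 r)//= yr add0r subr_le0; apply: le_trans.
by rewrite lerBlDr lerDl ltW.
Qed.

(** * The potential: bounds and change per request *)

Definition Psi (x y : 'rV[R]_n) : R :=
  \sum_(i < n) w i * (x 0 i - 2 * y 0 i * ln (x 0 i) - ln (1 / delta) * y 0 i).

Lemma feasible_ln (x : 'rV[R]_n) i :
  feasible x -> 0 <= - ln (x 0 i) <= ln (1 / delta).
Proof.
move=> [xb _]; have /andP[dx x1] := xb i.
have x0 : 0 < x 0 i := lt_le_trans delta_gt0 dx.
rewrite -ln1 ln_div ?posrE// ln1 sub0r lerN2 oppr_ge0 ler_ln ?posrE// dx.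
by rewrite -ln1 ler_ln ?posrE// x1.
Qed.

Lemma Psi_ge (x y : 'rV[R]_n) : feasible x -> (forall i, 0 <= y 0 i <= 1) ->
  - (\sum_(i < n) w i * ln (1 / delta)) <= Psi x y.
Proof.
move=> xf yb; rewrite -sumrN; apply: ler_sum => i _; rewrite -mulrN ler_pM2l//.
have /andP[l0 l1] := feasible_ln i xf; have /andP[y0 y1] := yb i.
have /andP[dx _] := xf.1 i.
have : 0 <= y 0 i * - ln (x 0 i) by rewrite mulr_ge0.
have : 0 <= (1 - y 0 i) * ln (1 / delta).
  by rewrite mulr_ge0 ?subr_ge0// (le_trans l0).
by move: delta_gt0; lra.
Qed.

Lemma Psi_le (x y : 'rV[R]_n) : feasible x -> (forall i, 0 <= y 0 i <= 1) ->
  Psi x y <= \sum_(i < n) w i * (1 + 2 * ln (1 / delta)).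
Proof.
move=> xf yb; apply: ler_sum => i _; rewrite ler_pM2l//.
have /andP[l0 l1] := feasible_ln i xf; have /andP[y0 y1] := yb i.
have /andP[_ x1] := xf.1 i.
have : y 0 i * - ln (x 0 i) <= 1 * ln (1 / delta) by apply: ler_pM.
have : 0 <= ln (1 / delta) * y 0 i by rewrite mulr_ge0// (le_trans l0).
by lra.
Qed.

(** First [y] moves at the old [x], then [x] moves at the new [y']. With [u = - ln x_i] in [[0, L]],
    a change [d] of [y_i] changes the potential by [w_i (2 u - L) d]; the shift by [L] centres the
    coefficient, which gives the factor [L] instead of [2 L]. *)
Lemma Psi_step (x x' y y' : 'rV[R]_n) (r : 'I_n) :
  feasible x -> step_spec x r x' ->
  (forall i, 0 <= y' 0 i <= 1) -> s <= \sum_(i < n) y' 0 i -> y' 0 r = 0 ->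
  wnorm1 w (x' - x) + (Psi x' y' - Psi x y)
    <= ln (1 / delta) * wnorm1 w (y' - y).
Proof.
move=> xf [_ _ H] yb ys yr; have {H} Hx := H y' yb ys yr.
rewrite -[leRHS]addr0 -lerBlDl; apply: le_trans Hx.
rewrite /wnorm1 /Psi mulr_sumr -!sumrB -big_split/= -sumrB.
apply: ler_sum => i _; rewrite !mxE.
have /andP[l0 l1] := feasible_ln i xf.
set u := - ln (x 0 i) in l0 l1 *; set L := ln (1 / delta) in l1 *.
have uE : ln (x 0 i) = - u by rewrite /u opprK.
rewrite uE; set d := y' 0 i - y 0 i.
have key : 0 <= w i * (L * `|d| + L * d - 2 * u * d).
  apply: mulr_ge0; first exact: ltW.
  have [d0|/ltW d0] := leP 0 d.
    rewrite ger0_norm//; have : 0 <= (L - u) * d by rewrite mulr_ge0// subr_ge0.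
    by lra.
  rewrite ler0_norm//; have : 0 <= u * - d by rewrite mulr_ge0// oppr_ge0.
  by lra.
by move: key; rewrite /d; lra.
Qed.

End Step.

(** * The online algorithm as a fold, and its competitive ratio *)

Lemma run_foldlS {R : realType} {n : nat} (step : 'rV[R]_n -> 'I_n -> 'rV[R]_n)
    (x0 : 'rV[R]_n) (r : nat -> 'I_n) (t : nat) :
  run (foldl step x0) r t.+1 = step (run (foldl step x0) r t) (r t.+1).
Proof. by rewrite /run -[t.+1]addn1 iotaD map_cat foldl_cat /= add1n addn1. Qed.

Theorem mainTheorem7 (R : realType) (n k h : nat)
    (hkn : (k < n)%N) (hhk : (h <= k)%N) (hh : (1 <= h)%N)
    (w : 'I_n -> R) (hw : forall i, 0 < w i) :
  let delta : R := delta_of k h in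
  exists (alg : online_algorithm R n) (C' : R),
  forall r : nat -> 'I_n,
    let x := run alg r in
    [/\ (forall t, antipaging_delta h delta (x t)
                   /\ norm1 (x t) = n%:R - h%:R),
        (forall t, (1 <= t)%N -> x t 0 (r t) = delta)
      & forall (T0 : nat) (y : nat -> 'rV[R]_n),
          (forall t, (t <= T0)%N -> (antipaging h `&` zero_one) (y t)) ->
          (forall t, (1 <= t <= T0)%N -> y t 0 (r t) = 0) ->
          movement w x T0 <= ln (1 / delta) * movement w y T0 + C'].
Proof.
move=> delta; pose s : R := n%:R - h%:R.
have kn : k%:R + 1 <= n%:R :> R by rewrite natr1 ler_nat.
have hk : h%:R <= k%:R :> R by rewrite ler_nat.
have h1 : 1 <= h%:R :> R by rewrite ler1n.
have delta0 : 0 < delta by rewrite /delta /delta_of divr_gt0//; lra.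
have sn : s <= n%:R - 1 + delta by rewrite /s; lra.
pose x0 : 'rV[R]_n := const_mx (s / n%:R).
have x0f : feasible delta s x0.
  split=> [i|].
    rewrite mxE /s ler_pdivlMr ?ler_pdivrMr; try lra.
    apply/andP; split; last by lra.
    rewrite /delta /delta_of mulrAC ler_pdivrMr; last by lra.
    (* This is [delta <= s / n] with denominators cleared: [delta = 1 - h / (k + 1/2)],
       [s / n = 1 - h / n], and [n >= k + 1]. *)
    have : 0 <= (n%:R - k%:R - 1 / 2) * h%:R :> R by rewrite mulr_ge0//; lra.
    by lra.
  under eq_bigr do rewrite mxE.
  by rewrite sumr_const card_ord -[LHS]mulr_natr divfK// gt_eqF//; lra.
have [step stepP] : exists step : 'rV[R]_n -> 'I_n -> 'rV[R]_n,
    forall x r, feasible delta s x -> step_spec w delta s x r (step x r).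
  have /choice[f fP] (xr : 'rV[R]_n * 'I_n) : exists x',
      feasible delta s xr.1 -> step_spec w delta s xr.1 xr.2 x'.
    (* The value 0 at infeasible points is a default that is never reached, since every iterate is
       feasible. *)
    have [xf|nxf] := pselect (feasible delta s xr.1); last by exists 0.
    by have [x' ?] := step_exists hw delta0 xr.2 xf sn; exists x'.
  by exists (fun x r => f (x, r)) => x r; exact: (fP (x, r)).
(* [C'] is the upper bound on the potential, used at time 0, minus its lower bound, used at time
   [T0]. *)
exists (foldl step x0), (\sum_(i < n) w i * (1 + 2 * ln (1 / delta))
                         + \sum_(i < n) w i * ln (1 / delta)) => r x.
have xS t : x t.+1 = step (x t) (r t.+1) by exact: run_foldlS.
have xf t : feasible delta s (x t).
  elim: t => [|t IH]; first exact: x0f.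
  by rewrite xS; have [] := stepP _ (r t.+1) IH.
split=> [t|[//|t] _|T0 y yP yr].
- have [xb xs] := xf t; split; first by split=> //; rewrite xs.
  rewrite /norm1 /wnorm1 -/s -xs; apply: eq_bigr => i _.
  rewrite mul1r ger0_norm//; have /andP[+ _] := xb i.
  exact/le_trans/ltW.
- by rewrite xS; have [] := stepP _ (r t.+1) (xf t).
have yb t : (t <= T0)%N -> forall i, 0 <= y t 0 i <= 1.
  by move=> /yP[[]].
have Psi_sum : movement w x T0 + (Psi w delta (x T0) (y T0)
    - Psi w delta (x 0%N) (y 0%N)) <= ln (1 / delta) * movement w y T0.
  (* The potential difference becomes a sum of one-step changes, so the claim reduces to each single
     step. *)
  rewrite -(telescope_sumr (fun t => Psi w delta (x t) (y t)) (leq0n T0)).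
  rewrite /movement !big_add1 /= -big_split/= mulr_sumr !big_mkord.
  apply: ler_sum => -[t tT] _ /=.
  have [[_ ys] _] := yP _ tT.
  have := stepP _ (r t.+1) (xf t); rewrite -xS => spec.
  exact: (Psi_step hw delta0 (y t) (xf t) spec (yb _ tT) ys (yr t.+1 tT)).
have := Psi_ge hw delta0 (xf T0) (yb _ (leqnn T0)).
have := Psi_le hw delta0 (xf 0%N) (yb _ (leq0n T0)).
by move: Psi_sum; lra.
Qed.
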